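(* Let $A$ be an integer $2\times2$ matrix with $\Delta_1>0$, $\Delta_2<0$, $\delta_1>0$, $\delta_2<0$ and $|\Delta_1|<|\Delta_2|$. Suppose that the optimal action of some states at time $t+1$ is already known. Consider the optimal action of state $s_{i,t}$ at time $t$. Then (1) if $s_{i,t}<s^{0\ast}$ and $y^\ast(s_{i,t+1})=e_R$, then $y^\ast(s_{i,t})=e_R$; (2) if $s_{i,t}\ge s^{0\ast}$ and $y^\ast(s_{i+1,t+1})=e_L$, then $y^\ast(s_{i,t})=e_L$.
   Context: $A=\begin{pmatrix} a_{11} & a_{12} \\ a_{21} & a_{22} \end{pmatrix}$; $\delta_1=a_{11}-a_{12}$, $\delta_2=a_{21}-a_{22}$, $\Delta_1=a_{11}-a_{21}$, $\Delta_2=a_{12}-a_{22}$; $e_L=(1,0)^T$, $e_R=(0,1)^T$. $T$ is the number of repetitions of the game and $\eta>0$, $\eta=O(\sqrt{1/T})$, is the learning rate of the Hedge algorithm used by player X. Possible states at time $t$: $s_{i,t}=-(t-i)\Delta_1-(i-1)\Delta_2$, $1\le i\le t$. Payoff function of player Y: $r(s,y)=\left(\frac{1}{e^{-\eta s}+1},\frac{e^{-\eta s}}{e^{-\eta s}+1}\right)Ay$. Transition: $h(s,y)=s+(-\Delta_1,-\Delta_2)y$, so that $e_L$ leads from $s_{i,t}$ to $s_{i,t+1}$ and $e_R$ leads from $s_{i,t}$ to $s_{i+1,t+1}$. Bellman optimality equation: $f^\ast(s_t)=\max_{y\in\{e_L,e_R\}}\{r(s_t,y)+f^\ast(h(s_t,y))\}$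 for $1\le t\le T$, where $s_t$ is a state at time $t$ and $f^\ast\equiv0$ at time $T+1$. The optimal action of $s_t$ is $y^\ast(s_t)=\arg\max_{y\in\{e_L,e_R\}}\{r(s_t,y)+f^\ast(h(s_t,y))\}$. $s^{0\ast}$ is the zero of the decreasing function $f(s)=-\Delta_2(1-e^{\eta\Delta_1})(e^{\eta s}+e^{\eta\Delta_2})+\Delta_1(1-e^{\eta\Delta_2})(e^{\eta s}+e^{\eta\Delta_1})$; it satisfies $\frac{\Delta_1+\Delta_2}{2}<s^{0\ast}<0$. *)

(* Defs.v *)
From HB Require Import structures.
From mathcomp Require Import all_boot all_order all_algebra.
From mathcomp Require Import all_classical all_reals all_analysis.

Set Implicit Arguments.
Unset Strict Implicit.
Unset Printing Implicit Defensive.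

Import Order.TTheory GRing.Theory Num.Theory.
Import numFieldNormedType.Exports.

Local Open Scope classical_set_scope.
Local Open Scope ring_scope.

(* Rows of A are the actions of player X, columns those of player Y. *)
Definition delta1 (A : 'M[int]_2) : int := A 0 0 - A 0 1.
Definition delta2 (A : 'M[int]_2) : int := A 1 0 - A 1 1.
Definition Delta1 (A : 'M[int]_2) : int := A 0 0 - A 1 0.
Definition Delta2 (A : 'M[int]_2) : int := A 0 1 - A 1 1.

Section Game.
Context {R : realType}.
Implicit Types (A : 'M[int]_2) (eta s : R) (y z : 'cV[R]_2) (T t i n : nat).

Definition e_L : 'cV[R]_2 := delta_mx 0 0.
Definition e_R : 'cV[R]_2 := delta_mx 1 0.

Definition state A i t : R :=
  - (t%:R - i%:R) * (Delta1 A)%:~R - (i%:R - 1) * (Delta2 A)%:~R.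

Definition hedge eta s : 'rV[R]_2 :=
  \row_j (if j == 0 then 1 / (expR (- eta * s) + 1)
          else expR (- eta * s) / (expR (- eta * s) + 1)).

Definition payoff A eta s y : R := (hedge eta s *m map_mx intr A *m y) 0 0.

Definition Delta_row A : 'rV[R]_2 :=
  \row_j (if j == 0 then - (Delta1 A)%:~R else - (Delta2 A)%:~R).

Definition transition A s y : R := s + (Delta_row A *m y) 0 0.

(* Optimal payoff of player Y from s when n rounds remain. *)
Fixpoint value A eta n s : R :=
  if n is n'.+1 then
    Num.max (payoff A eta s e_L + value A eta n' (transition A s e_L))
            (payoff A eta s e_R + value A eta n' (transition A s e_R))
  else 0.

(* Rounds are numbered 1..T, so T + 1 - t of them remain at time t. *)
Definition fstar A eta T t s : R := value A eta (T.+1 - t) s.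

Definition action_value A eta T t s y : R :=
  payoff A eta s y + fstar A eta T t.+1 (transition A s y).

Lemma fstar_terminal A eta T s : fstar A eta T T.+1 s = 0.
Proof. by rewrite /fstar subnn. Qed.

Lemma fstar_bellman A eta T t s : (1 <= t <= T)%N ->
  fstar A eta T t s =
  Num.max (action_value A eta T t s e_L) (action_value A eta T t s e_R).
Proof. by move=> /andP[_ tT]; rewrite /action_value /fstar subSn. Qed.

(* The argmax as a set: in case of a tie both actions belong to it. *)
Definition ystar A eta T t s : set 'cV[R]_2 :=
  [set y | [set e_L; e_R] y /\
    forall z, [set e_L; e_R] z ->
      action_value A eta T t s z <= action_value A eta T t s y].

(* f; its unique real zero is s^{0*}. *)
Definition threshold_fun A eta s : R :=
  - (Delta2 A)%:~R * (1 - expR (eta * (Delta1 A)%:~R))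
      * (expR (eta * s) + expR (eta * (Delta2 A)%:~R))
  + (Delta1 A)%:~R * (1 - expR (eta * (Delta2 A)%:~R))
      * (expR (eta * s) + expR (eta * (Delta1 A)%:~R)).

End Game.

(* Main.v *)
Require Import Defs.
From mathcomp Require Import all_boot all_order all_algebra.
From mathcomp Require Import all_classical all_reals all_analysis.
From mathcomp Require Import ring lra.

Import Order.TTheory GRing.Theory Num.Theory.
Import numFieldNormedType.Exports.

Local Open Scope classical_set_scope.
Local Open Scope ring_scope.

(** An exchange argument: playing [e_L] then [e_R] leads to the same state as
    playing [e_R] then [e_L]. If the optimal action after the first move of one
    of these plays is its second move, then that play realises the value of its
    first move, while the other play bounds the value of its first move from
    below; so it suffices to compare the payoffs of the two rounds. Their
    difference is a positive multiple of [threshold_fun], which is nonincreasing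
    because [1 + x <= expR x]. *)

Lemma mulmx_e_L (R : realType) (u : 'rV[R]_2) : (u *m e_L) 0 0 = u 0 0.
Proof. by rewrite /e_L -colE mxE. Qed.

Lemma mulmx_e_R (R : realType) (u : 'rV[R]_2) : (u *m e_R) 0 0 = u 0 1.
Proof. by rewrite /e_R -colE mxE. Qed.

Section Exchange.
Variables (R : realType) (A : 'M[int]_2).
Implicit Types (eta s : R) (T t i : nat).

Local Notation D1 := ((Delta1 A)%:~R : R).
Local Notation D2 := ((Delta2 A)%:~R : R).

Lemma transition_e_L s : transition A s e_L = s - D1.
Proof. by rewrite /transition mulmx_e_L mxE. Qed.

Lemma transition_e_R s : transition A s e_R = s - D2.
Proof. by rewrite /transition mulmx_e_R mxE. Qed.

Lemma transitionC s :
  transition A (transition A s e_L) e_R = transition A (transition A s e_R) e_L.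
Proof. by rewrite !transition_e_L !transition_e_R addrAC. Qed.

Lemma transition_state_e_L i t :
  transition A (state A i t) e_L = state A i t.+1 :> R.
Proof. by rewrite transition_e_L /state -natr1; ring. Qed.

Lemma transition_state_e_R i t :
  transition A (state A i t) e_R = state A i.+1 t.+1 :> R.
Proof. by rewrite transition_e_R /state -!natr1; ring. Qed.

(** Multiplying numerator and denominator of the hedge weights by [expR (eta * s)] makes the weight
    of the first row [x / (x + 1)] with [x = expR (eta * s)]. A move of the state then merely
    divides [x] by a constant. *)
Lemma payoff_e_L eta s :
  payoff A eta s e_L = (A 1 0)%:~R + D1 * (expR (eta * s) / (expR (eta * s) + 1)).
Proof.
rewrite /payoff mulmx_e_L mxE !big_ord_recl big_ord0 !mxE /= /Delta1 intrB.
rewrite mulNr expRN; have := expR_gt0 (eta * s); set x := expR _ => x0.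
have -> : lift ord0 ord0 = 1 :> 'I_2 by apply/val_inj.
by field; rewrite !gt_eqF //; lra.
Qed.

Lemma payoff_e_R eta s :
  payoff A eta s e_R = (A 1 1)%:~R + D2 * (expR (eta * s) / (expR (eta * s) + 1)).
Proof.
rewrite /payoff mulmx_e_R mxE !big_ord_recl big_ord0 !mxE /= /Delta2 intrB.
rewrite mulNr expRN; have := expR_gt0 (eta * s); set x := expR _ => x0.
have -> : lift ord0 ord0 = 1 :> 'I_2 by apply/val_inj.
by field; rewrite !gt_eqF //; lra.
Qed.

(** The constants [A 1 0] and [A 1 1] occur in both plays and cancel. After [e_L] the weight
    [x / (x + 1)] becomes [x / (x + expR (eta * D1))], and similarly with [D2] after [e_R]; a common
    denominator gives the formula. *)
Lemma payoff_exchange eta s :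
  (payoff A eta s e_R + payoff A eta (transition A s e_R) e_L)
  - (payoff A eta s e_L + payoff A eta (transition A s e_L) e_R)
  = expR (eta * s) / ((expR (eta * s) + 1) * (expR (eta * s) + expR (eta * D1))
                      * (expR (eta * s) + expR (eta * D2)))
    * threshold_fun A eta s.
Proof.
rewrite !payoff_e_L !payoff_e_R transition_e_L transition_e_R /threshold_fun.
rewrite !mulrBr !expRD !expRN.
have := expR_gt0 (eta * s); set x := expR (eta * s) => x0.
have := expR_gt0 (eta * D1); set u := expR (eta * D1) => u0.
have := expR_gt0 (eta * D2); set v := expR (eta * D2) => v0.
by field; rewrite !gt_eqF //; lra.
Qed.

Lemma payoff_exchange_ge0 eta s : 0 <= threshold_fun A eta s ->
  payoff A eta s e_L + payoff A eta (transition A s e_L) e_R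
  <= payoff A eta s e_R + payoff A eta (transition A s e_R) e_L.
Proof.
by move=> f0; rewrite -subr_ge0 payoff_exchange mulr_ge0.
Qed.

Lemma payoff_exchange_le0 eta s : threshold_fun A eta s <= 0 ->
  payoff A eta s e_R + payoff A eta (transition A s e_R) e_L
  <= payoff A eta s e_L + payoff A eta (transition A s e_L) e_R.
Proof.
by move=> f0; rewrite -subr_le0 payoff_exchange mulr_ge0_le0.
Qed.

Lemma threshold_fun_nonincreasing eta s s' :
  0 <= eta -> 0 <= Delta1 A -> Delta2 A <= 0 -> s <= s' ->
  threshold_fun A eta s' <= threshold_fun A eta s.
Proof.
move=> eta0; rewrite -(ler0z R) -(lerz0 R) => D1_ge0 D2_le0 ss'.
have xx' : expR (eta * s) <= expR (eta * s') by rewrite ler_expR ler_wpM2l.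
have u_ge := expR_ge1Dx (eta * D1).
have v_ge := expR_ge1Dx (eta * D2).
rewrite /threshold_fun -subr_ge0.
move: xx' u_ge v_ge; set x := expR (eta * s); set x' := expR (eta * s').
set u := expR (eta * D1); set v := expR (eta * D2) => xx' u_ge v_ge.
(* [threshold_fun] is affine in [x], with slope [- (- D2 * (u - 1) + D1 * (v - 1))]. The added terms
   [eta * D1] and [eta * D2] cancel each other and make both summands nonnegative. *)
have slope : 0 <= - D2 * (u - 1 - eta * D1) + D1 * (v - 1 - eta * D2).
  by rewrite addr_ge0 // mulr_ge0 //; lra.
have : 0 <= (x' - x) * (- D2 * (u - 1 - eta * D1) + D1 * (v - 1 - eta * D2)).
  by rewrite mulr_ge0 // subr_ge0.
by congr (0 <= _); ring.
Qed.

Lemma ystar_e_L eta T t s :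
  ystar A eta T t s e_L <->
  action_value A eta T t s e_R <= action_value A eta T t s e_L.
Proof.
split=> [[_ opt]|le_RL]; first by apply: opt; right.
by split=> [|z [] ->]; first by left.
Qed.

Lemma ystar_e_R eta T t s :
  ystar A eta T t s e_R <->
  action_value A eta T t s e_L <= action_value A eta T t s e_R.
Proof.
split=> [[_ opt]|le_LR]; first by apply: opt; left.
by split=> [|z [] ->]; first by right.
Qed.

Lemma ystar_e_R_step eta T t s : (t < T)%N -> 0 <= threshold_fun A eta s ->
  ystar A eta T t.+1 (transition A s e_L) e_R -> ystar A eta T t s e_R.
Proof.
move=> tT /payoff_exchange_ge0 le_LR /ystar_e_R optR; apply/ystar_e_R.
rewrite /action_value !(@fstar_bellman _ _ _ _ t.+1) // (max_idPr optR).
(* The intermediate value is that of playing [e_R] then [e_L]. Its continuation equals that of [e_L]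
   then [e_R], so only [le_LR] is left; the maximum after [e_R] then dominates its [e_L] branch. *)
apply: (@le_trans _ _ (payoff A eta s e_R
  + action_value A eta T t.+1 (transition A s e_R) e_L)).
  by rewrite /action_value transitionC !addrA lerD2r.
by rewrite lerD2l le_max lexx.
Qed.

Lemma ystar_e_L_step eta T t s : (t < T)%N -> threshold_fun A eta s <= 0 ->
  ystar A eta T t.+1 (transition A s e_R) e_L -> ystar A eta T t s e_L.
Proof.
move=> tT /payoff_exchange_le0 le_RL /ystar_e_L optL; apply/ystar_e_L.
rewrite /action_value !(@fstar_bellman _ _ _ _ t.+1) // (max_idPl optL).
apply: (@le_trans _ _ (payoff A eta s e_L
  + action_value A eta T t.+1 (transition A s e_L) e_R)).
  by rewrite /action_value transitionC !addrA lerD2r.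
by rewrite lerD2l le_max lexx orbT.
Qed.

End Exchange.

Theorem lemma5p2 (R : realType) (A : 'M[int]_2)
  (hDelta1 : 0 < Delta1 A) (hDelta2 : Delta2 A < 0)
  (hdelta1 : 0 < delta1 A) (hdelta2 : delta2 A < 0)
  (hDelta : `|Delta1 A| < `|Delta2 A|)
  (eta : nat -> R) (heta_gt0 : forall T : nat, (0 < T)%N -> 0 < eta T)
  (heta_O : eta =O_\oo (fun T : nat => Num.sqrt (1 / T%:R) : R))
  (T t i : nat) (hi : (1 <= i <= t)%N) (ht : (t < T)%N)
  (s0 : R) (hs0 : threshold_fun A (eta T) s0 = 0) :
  (state A i t < s0 ->
     ystar A (eta T) T t.+1 (state A i t.+1) e_R ->
     ystar A (eta T) T t (state A i t) e_R) /\
  (s0 <= state A i t ->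
     ystar A (eta T) T t.+1 (state A i.+1 t.+1) e_L ->
     ystar A (eta T) T t (state A i t) e_L).
Proof.
have eta_ge0 : 0 <= eta T by rewrite ltW ?heta_gt0 ?(leq_ltn_trans _ ht).
have f_le s s' := @threshold_fun_nonincreasing R A (eta T) s s'
  eta_ge0 (ltW hDelta1) (ltW hDelta2).
(* With both successors written as transitions, monotonicity turns the position relative to [s0]
   into the sign of [threshold_fun]. *)
rewrite -transition_state_e_L -transition_state_e_R; split=> hs.
  by apply: ystar_e_R_step => //; rewrite -hs0 f_le ?ltW.
by apply: ystar_e_L_step => //; rewrite -hs0 f_le.
Qed.
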